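(* Let $G=(V_G,E_G)$ and $H=(V_H,E_H)$ be finite simple connected graphs with $|V_G|=n$, $|V_H|=m$, $V_G=\{x_1,\dots,x_n\}$. Let $u=(y_1,\ldots,y_n)x\in V_{G\wr H}$ and $p=\frac{m-1}{m}$. Then $u$ is median in $G\wr H$ if and only if $y_1,\dots,y_n$ are all median in $H$ and $x$ is $p$TS-median in $G$. In particular, $G\wr H$ is distance-balanced if and only if $G$ is $p$TS-distance-balanced and $H$ is distance-balanced.
   Context: For a graph $K$ of order $N$, $d_K(u)=\frac1N\sum_{v}d_K(u,v)$ (geodesic distance); $u$ is median if $d_K(u)=\min_v d_K(v)$. $K$ is distance-balanced if for every edge $uv$, $|\{z:d_K(z,u)<d_K(z,v)\}|=|\{z:d_K(z,v)<d_K(z,u)\}|$. For $A\subseteq V_G$, $\rho_A(u,v)$ is the length of a shortest walk in $G$ from $u$ to $v$ visiting every vertex of $A$; $p_A=p^{|A|}(1-p)^{n-|A|}$; $d_G^p(u)=\frac1n\sum_{v}\sum_{A\subseteq V_G}p_A\rho_A(u,v)$; $x$ is $p$TS-median if $d_G^p(x)=\min_v d_G^p(v)$. For edges $uv$ of $G$, $W^A_{uv}=\{z:\rho_A(z,u)<\rho_A(z,v)\}$, $w^p_{uv}=\sum_A p_A|W^A_{uv}|$; $G$ is $p$TS-distance-balanced if $w^p_{uv}=w^p_{vu}$ for every edge $uv$. The wreath product $G\wr H$ has vertex set $\{(y_1,\dots,y_n)x_i: y_j\in V_H, x_i\in V_G\}$ with $(y_1,\dots,y_n)x_i\sim(y'_1,\dots,y'_n)x_k$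 iff either ($i=k$, $y_j=y'_j$ for $j\ne i$, $y_i\sim y'_i$ in $H$) or ($y_j=y'_j$ for all $j$ and $x_i\sim x_k$ in $G$). *)

(* Defs.v *)
From HB Require Import structures.
From mathcomp Require Import all_boot all_order all_algebra.
From mathcomp Require Import boolp.

Set Implicit Arguments.
Unset Strict Implicit.
Unset Printing Implicit Defensive.

Import Order.TTheory GRing.Theory Num.Theory.
Local Open Scope ring_scope.

Record sgraph := SGraph {
  vertex :> finType;
  adj : rel vertex;
  adj_sym : symmetric adj;
  adj_irr : irreflexive adj }.
Arguments adj {s}.

(* The graph without vertices does not count as connected. *)
Definition connected_graph (K : sgraph) : Prop :=
  (0 < #|K|)%N /\ forall u v : K, connect adj u v.

(* Least k with P k; the value 0 when there is none is never reached for the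
   walk lengths below when the graph is connected. *)
Definition least (P : pred nat) : nat :=
  match pselect (exists k, P k) with
  | left exP => ex_minn exP
  | right _ => 0%N
  end.

(* A walk of length k from u is the list u :: s, with s of size k. *)
Definition has_walk (K : sgraph) (u v : K) (k : nat) : bool :=
  [exists s : k.-tuple K, path adj u s && (last u s == v)].

Definition has_walk_through (K : sgraph) (A : {set K}) (u v : K) (k : nat)
  : bool :=
  [exists s : k.-tuple K,
    [&& path adj u s, last u s == v & [forall a in A, a \in u :: s]]].

Definition dist (K : sgraph) (u v : K) : nat := least (has_walk u v).

Definition rho (G : sgraph) (A : {set G}) (u v : G) : nat :=
  least (has_walk_through A u v).

Definition mean_dist (K : sgraph) (u : K) : rat :=
  #|K|%:R^-1 * \sum_(v : K) (dist u v)%:R.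

Definition median (K : sgraph) (u : K) : Prop :=
  forall v : K, mean_dist u <= mean_dist v.

Definition distance_balanced (K : sgraph) : Prop :=
  forall u v : K, adj u v ->
    #|[set z : K | (dist z u < dist z v)%N]| =
    #|[set z : K | (dist z v < dist z u)%N]|.

Definition prob (G : sgraph) (p : rat) (A : {set G}) : rat :=
  p ^+ #|A| * (1 - p) ^+ (#|G| - #|A|).

Definition TS_mean_dist (G : sgraph) (p : rat) (u : G) : rat :=
  #|G|%:R^-1 *
  \sum_(v : G) \sum_(A : {set G}) prob p A * (rho A u v)%:R.

Definition TS_median (G : sgraph) (p : rat) (x : G) : Prop :=
  forall v : G, TS_mean_dist p x <= TS_mean_dist p v.

Definition W (G : sgraph) (A : {set G}) (u v : G) : {set G} :=
  [set z | (rho A z u < rho A z v)%N].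

Definition w (G : sgraph) (p : rat) (u v : G) : rat :=
  \sum_(A : {set G}) prob p A * #|W A u v|%:R.

Definition TS_distance_balanced (G : sgraph) (p : rat) : Prop :=
  forall u v : G, adj u v -> w p u v = w p v u.

(* The vertex (y_1, ..., y_n) x_i is the pair (y, x_i), with the tuple y
   indexed by the vertices x_1, ..., x_n of G themselves. *)
Definition wreath_adj (G H : sgraph) : rel ({ffun G -> H} * G) := fun u v =>
  [&& u.2 == v.2,
      [forall j, (j != u.2) ==> (u.1 j == v.1 j)]
    & adj (u.1 u.2) (v.1 u.2)]
  || (u.1 == v.1) && adj u.2 v.2.

Lemma wreath_adj_sym (G H : sgraph) : symmetric (@wreath_adj G H).
Proof.
have imp u v : @wreath_adj G H u v -> @wreath_adj G H v u.
  case: u v => [y x] [y' x'] /orP[/and3P[/= /eqP <- /forallP yy' e]|/=].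
    apply/orP; left; rewrite /= eqxx adj_sym e andbT /=.
    by apply/forallP => j; rewrite [y' j == _]eq_sym.
  move=> /andP[/eqP -> e]; apply/orP; right => /=.
  by rewrite eqxx adj_sym e.
by move=> u v; apply/idP/idP => /imp.
Qed.

Lemma wreath_adj_irr (G H : sgraph) : irreflexive (@wreath_adj G H).
Proof. by move=> u; rewrite /wreath_adj !adj_irr !andbF. Qed.

Definition wreath (G H : sgraph) : sgraph :=
  SGraph (@wreath_adj_sym G H) (@wreath_adj_irr G H).

(* Main.v *)
(* A shortest walk from (y, x) to (y', x') in the wreath product projects to a
   walk in G that visits every coordinate where y and y' differ, and spends the
   remaining steps moving each y_j to y'_j in H; hence
     d((y, x), (y', x')) = rho_A(x, x') + sum_j d_H(y_j, y'_j),
   where A is the set of coordinates where y and y' differ.  Exactly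
   (m - 1)^|A| = m^n p_A tuples y' differ from y on A, so the total distance
   from (y, x) is, up to positive factors, the sum of the expected
   travelling-salesman distance from x and of the total distances from the y_j
   in H.  Medians are read off this formula, and so is distance-balancedness:
   distances to adjacent vertices differ by at most one, so both balance
   conditions say that the corresponding total distance is the same at adjacent
   vertices. *)
Require Import Defs.
From mathcomp Require Import all_boot all_order all_algebra.
From mathcomp Require Import boolp zify.
Import Order.TTheory GRing.Theory Num.Theory.

Set Implicit Arguments.
Unset Strict Implicit.
Unset Printing Implicit Defensive.

Local Open Scope nat_scope.

(** * The least natural number satisfying a predicate *)

Section Least.

Variable P : pred nat.

Lemma least_sat k : P k -> P (least P).
Proof.
rewrite /least; case: pselect => [exP _|nP Pk]; first by case: ex_minnP.
by case: nP; exists k.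
Qed.

Lemma least_le k : P k -> least P <= k.
Proof.
rewrite /least; case: pselect => [exP Pk|//].
by case: ex_minnP => i _; apply.
Qed.

End Least.

(** * Walks, distances and walks through a prescribed set *)

Section Walks.

Variable K : sgraph.
Implicit Types (u v z : K) (A : {set K}).

Lemma has_walkP u v k :
  reflect (exists s : seq K, [/\ size s = k, path adj u s & last u s = v])
          (has_walk u v k).
Proof.
apply: (iffP existsP) => [[s /andP[us /eqP lv]]|[s [sk us lv]]].
  by exists s; rewrite size_tuple.
by exists (tcast sk (in_tuple s)); rewrite val_tcast us lv eqxx.
Qed.

Lemma has_walk_throughP A u v k :
  reflect (exists s : seq K, [/\ size s = k, path adj u s, last u s = v
                             & {subset A <= u :: s}])
          (has_walk_through A u v k).
Proof.
apply: (iffP existsP) => [[s /and3P[us /eqP lv As]]|[s [sk us lv As]]].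
  by exists s; rewrite size_tuple; split=> // a; move/forall_inP: As; apply.
exists (tcast sk (in_tuple s)); rewrite val_tcast us lv eqxx /=.
exact/forall_inP.
Qed.

Lemma has_walk0 u : has_walk u u 0.
Proof. by apply/has_walkP; exists [::]. Qed.

Lemma has_walk1 u v : adj u v -> has_walk u v 1.
Proof. by move=> uv; apply/has_walkP; exists [:: v] => /=; rewrite uv. Qed.

Lemma has_walkD u v z k l :
  has_walk u v k -> has_walk v z l -> has_walk u z (k + l).
Proof.
move=> /has_walkP[s [sk us sv]] /has_walkP[t [tl vt tz]].
apply/has_walkP; exists (s ++ t).
by rewrite size_cat sk tl cat_path us sv vt last_cat sv.
Qed.

Lemma dist_le u v k : has_walk u v k -> dist u v <= k.
Proof. exact: least_le. Qed.

Lemma dist_xx u : dist u u = 0.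
Proof. by apply/eqP; rewrite -leqn0; apply/dist_le/has_walk0. Qed.

Lemma rho_le A u (s : seq K) :
  path adj u s -> {subset A <= u :: s} -> rho A u (last u s) <= size s.
Proof. by move=> us As; apply/least_le/has_walk_throughP; exists s. Qed.

Lemma has_walk_through_sym A u v k :
  has_walk_through A u v k = has_walk_through A v u k.
Proof.
suff imp x z : has_walk_through A x z k -> has_walk_through A z x k.
  by apply/idP/idP; apply: imp.
move=> /has_walk_throughP[s [sk us lv As]]; apply/has_walk_throughP.
have Es : z :: rev (belast x s) = rev (x :: s).
  by rewrite [in RHS]lastI rev_rcons lv.
exists (rev (belast x s)); split; first by rewrite size_rev size_belast.
- rewrite -lv rev_path; apply: sub_path us => a b; by rewrite adj_sym.
- by rewrite -[LHS]/(last z (z :: _)) Es rev_cons last_rcons.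
- by move=> a Aa; rewrite Es mem_rev; apply: As.
Qed.

Lemma rho_sym A u v : rho A u v = rho A v u.
Proof.
rewrite /rho; congr least; apply: funext => k; exact: has_walk_through_sym.
Qed.

Lemma dist_rho0 u v : dist u v = rho set0 u v.
Proof.
rewrite /dist /rho; congr least; apply: funext => k.
apply/has_walkP/has_walk_throughP => [][s [sk us lv]]; exists s; split=> //.
by move=> a; rewrite in_set0.
Qed.

Lemma dist_sym u v : dist u v = dist v u.
Proof. by rewrite !dist_rho0 rho_sym. Qed.

Hypothesis connK : forall u v, connect (@adj K) u v.

(** Connectedness keeps [least] away from its default value 0: connecting paths through the
    successive elements of [enum A], and finally to [v], concatenate to a walk that visits [A]. *)
Lemma rho_walk A u v : has_walk_through A u v (rho A u v).
Proof.
suff [s [us lv As]] : exists s, [/\ path adj u s, last u s = v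
                                 & {subset enum A <= u :: s}].
  apply: (@least_sat _ (size s)); apply/has_walk_throughP; exists s.
  by split=> // a Aa; apply: As; rewrite mem_enum.
elim: (enum A) u => [|a r IH] u.
  by have /connectP[s us ->] := connK u v; exists s; split.
have /connectP[s us ea] := connK u a.
have [t [at' lv rt]] := IH a.
exists (s ++ t); rewrite cat_path us last_cat -ea at' lv; split=> // b.
have aus : a \in u :: s by rewrite ea mem_last.
rewrite inE => /predU1P[->|/rt]; rewrite -cat_cons mem_cat ?aus //.
by rewrite inE => /predU1P[->|->]; rewrite ?aus // orbT.
Qed.

Lemma dist_walk u v : has_walk u v (dist u v).
Proof.
rewrite dist_rho0; have /has_walk_throughP[s [sk us lv _]] := rho_walk set0 u v.
by apply/has_walkP; exists s.
Qed.

Lemma dist_adj_le u v z : adj u v -> dist u z <= (dist v z).+1.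
Proof.
by move=> uv; apply: dist_le; apply: (has_walkD (has_walk1 uv)); apply: dist_walk.
Qed.

Lemma rho_adj_le A u v z : adj u v -> rho A z u <= (rho A z v).+1.
Proof.
rewrite adj_sym => vu; have /has_walk_throughP[s [sk us lv As]] := rho_walk A z v.
have -> : u = last z (rcons s u) by rewrite last_rcons.
rewrite -sk -(size_rcons s u); apply: rho_le; first by rewrite rcons_path us lv.
by move=> a /As; rewrite -rcons_cons mem_rcons [in X in _ -> X]inE orbC => ->.
Qed.

End Walks.

(** Pointwise, two naturals at distance at most one become equal once 1 is added to the strictly
    smaller one. This trades the cardinalities in a balance condition for sums of distances. *)
Lemma sum_card_lt (T : finType) (f g : T -> nat) :
    (forall z, f z <= (g z).+1) -> (forall z, g z <= (f z).+1) ->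
  \sum_z f z + #|[set z | f z < g z]| = \sum_z g z + #|[set z | g z < f z]|.
Proof.
move=> fg gf.
have cE (P : pred T) : #|[set z | P z]| = \sum_z (P z : nat).
  by rewrite -sum1dep_card big_mkcond; apply: eq_bigr => z _; case: (P z).
rewrite !cE -!big_split; apply: eq_bigr => z _ /=.
by have := fg z; have := gf z; case: ltngtP; lia.
Qed.

(** * Medians and balance through integer-valued total distances *)

Section TotalDistance.

Variable K : sgraph.
Hypothesis connK : forall u v : K, connect adj u v.

Definition total_dist (u : K) : nat := \sum_(v : K) dist u v.

(** For [c = m.-1] and [p = (m - 1) / m], this is the travelling-salesman mean distance scaled by
    [#|K| * m ^ #|K|], which makes it an integer. *)
Definition total_rho (c : nat) (u : K) : nat :=
  \sum_(A : {set K}) c ^ #|A| * \sum_(v : K) rho A u v.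

Lemma median_total_dist (u : K) :
  median u <-> forall v : K, total_dist u <= total_dist v.
Proof.
have K0 : (0 < #|K|%:R^-1 :> rat)%R.
  by rewrite invr_gt0 ltr0n; apply/card_gt0P; exists u.
by split=> h v; move: (h v);
  rewrite /mean_dist -!natr_sum ler_pM2l // ler_nat.
Qed.

Lemma distance_balanced_total_dist :
  distance_balanced K <->
  forall u v : K, adj u v -> total_dist u = total_dist v.
Proof.
have E (u v : K) : adj u v ->
    total_dist u + #|[set z : K | dist z u < dist z v]| =
    total_dist v + #|[set z : K | dist z v < dist z u]|.
  move=> uv; rewrite /total_dist.
  (* Total distances run over the second argument of [dist], the balance sets over the first;
     symmetry aligns them. *)
  under eq_bigr do rewrite dist_sym.
  under [X in _ = X + _]eq_bigr do rewrite dist_sym.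
  apply: sum_card_lt => z; rewrite !(dist_sym z); apply: dist_adj_le => //.
  by rewrite adj_sym.
by split=> h u v uv; have := h u v uv; have := E u v uv; lia.
Qed.

Variable m : nat.
Hypothesis m_gt0 : 0 < m.

Let p : rat := ((m%:R - 1) / m%:R)%R.

(** Since [1 - p = 1 / m], each vertex contributes a factor [1 / m] whether or not it lies in [A],
    and those in [A] a further [m - 1]. *)
Lemma prob_pred_div (A : {set K}) :
  (prob p A = (m ^ #|K|)%:R^-1 * (m.-1 ^ #|A|)%:R)%R.
Proof.
have m0 : (m%:R != 0 :> rat)%R by rewrite pnatr_eq0 -lt0n.
rewrite /prob; have -> : (p = m.-1%:R / m%:R)%R by rewrite /p -subn1 natrB.
have -> : (1 - m.-1%:R / m%:R = m%:R^-1 :> rat)%R.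
  by rewrite -[X in (X - _)%R](divff m0) -mulrBl -natrB ?leq_pred //
    -subn1 subKn // mul1r.
rewrite exprMn -mulrA -exprD subnKC ?max_card // mulrC exprVn.
by rewrite !natrX.
Qed.

Lemma TS_median_total_rho (x : K) :
  TS_median p x <-> forall v : K, total_rho m.-1 x <= total_rho m.-1 v.
Proof.
have E (v : K) : (TS_mean_dist p v =
    #|K|%:R^-1 * (m ^ #|K|)%:R^-1 * (total_rho m.-1 v)%:R)%R.
  rewrite /TS_mean_dist /total_rho exchange_big -mulrA; congr (_ * _)%R.
  rewrite natr_sum mulr_sumr; apply: eq_bigr => A _.
  by rewrite prob_pred_div -mulr_sumr -natr_sum -mulrA natrM.
have K0 : (0 < #|K|%:R^-1 * (m ^ #|K|)%:R^-1 :> rat)%R.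
  rewrite -invfM -natrM invr_gt0 ltr0n muln_gt0 expn_gt0 m_gt0 andbT.
  by apply/card_gt0P; exists x.
by split=> h v; move: (h v); rewrite !E ler_pM2l // ler_nat.
Qed.

Lemma TS_distance_balanced_total_rho :
  TS_distance_balanced K p <->
  forall u v : K, adj u v -> total_rho m.-1 u = total_rho m.-1 v.
Proof.
pose wn (u v : K) := \sum_(A : {set K}) m.-1 ^ #|A| * #|W A u v|.
have Ew (u v : K) : (w p u v = (m ^ #|K|)%:R^-1 * (wn u v)%:R)%R.
  rewrite /w /wn natr_sum mulr_sumr; apply: eq_bigr => A _.
  by rewrite prob_pred_div -mulrA natrM.
have M0 : ((m ^ #|K|)%:R^-1 != 0 :> rat)%R.
  by rewrite invr_eq0 pnatr_eq0 -lt0n expn_gt0 m_gt0.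
(* [sum_card_lt] applies to each [A] separately, because appending one edge to a walk through [A]
   changes [rho A] by at most one; the weighted sum over [A] follows. *)
have E (u v : K) : adj u v -> total_rho m.-1 u + wn u v = total_rho m.-1 v + wn v u.
  move=> uv; rewrite /total_rho /wn -!big_split; apply: eq_bigr => A _ /=.
  rewrite -!mulnDr; congr (_ * _).
  under eq_bigr do rewrite rho_sym.
  under [X in _ = X + _]eq_bigr do rewrite rho_sym.
  apply: sum_card_lt => z; apply: rho_adj_le => //; by rewrite adj_sym.
split=> h u v uv; have := h u v uv; have := E u v uv; rewrite ?Ew.
  by move=> Euv /(mulfI M0)/eqP; rewrite eqr_nat => /eqP; lia.
by move=> Euv Eu; congr (_ * _%:R)%R; lia.
Qed.

End TotalDistance.

(** * Distances and total distances in the wreath product *)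

Section Wreath.

Variables G H : sgraph.
Hypothesis connG : forall u v : G, connect adj u v.
Hypothesis connH : forall u v : H, connect adj u v.
Implicit Types (x : G) (y : {ffun G -> H}).

Definition diff_set y y' : {set G} := [set j | y j != y' j].

Definition upd y x (b : H) : {ffun G -> H} :=
  [ffun j => if j == x then b else y j].

Lemma wreath_adj_upd y x (a b : H) :
  adj a b -> @adj (wreath G H) (upd y x a, x) (upd y x b, x).
Proof.
move=> ab; apply/orP; left; rewrite /= eqxx !ffunE eqxx ab andbT /=.
by apply/forallP => j; apply/implyP => /negPf jx; rewrite !ffunE jx.
Qed.

Lemma wreath_walk_upd y x (b : H) k :
  has_walk (y x) b k -> @has_walk (wreath G H) (y, x) (upd y x b, x) k.
Proof.
(* Writing the start as an update too lets the induction on the walk in [H] vary its first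
   vertex. *)
have Ey : upd y x (y x) = y.
  by apply/ffunP => j; rewrite ffunE; case: eqP => [->|].
suff walk a : has_walk a b k ->
    @has_walk (wreath G H) (upd y x a, x) (upd y x b, x) k.
  by move/walk; rewrite Ey.
move=> /has_walkP[s [sk]]; elim: s k a sk => [|c s IH] k a <- /=.
  by move=> _ ->; apply: has_walk0.
move=> /andP[ac cs] lb.
by apply: (has_walkD (has_walk1 (wreath_adj_upd y x ac))); apply: IH.
Qed.

(** At each vertex reached, the coordinate there is moved to its final value along a geodesic of [H]
    before the walk goes on; a later visit to the same vertex finds nothing left to change. *)
Lemma wreath_walk_of_walk (s : seq G) x y y' :
    path adj x s -> {subset diff_set y y' <= x :: s} ->
  @has_walk (wreath G H) (y, x) (y', last x s)
    (size s + \sum_j dist (y j) (y' j)).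
Proof.
elim: s x y => [|a s IH] x y /=.
  (* At the end of the walk only the coordinate at the current vertex can still be wrong. *)
  move=> _ sub; have Ey : upd y x (y' x) = y'.
    apply/ffunP => j; rewrite ffunE; case: eqP => [->//|/eqP jx].
    apply/eqP; apply: contraNT jx => yj.
    by rewrite -mem_seq1; apply: sub; rewrite inE.
  rewrite add0n (bigD1 x) //= big1 ?addn0.
    by have := wreath_walk_upd (dist_walk connH (y x) (y' x)); rewrite Ey.
  by move=> j jx; rewrite -Ey ffunE (negPf jx) dist_xx.
move=> /andP[xa as_] sub; set z := upd y x (y' x).
have dzE : \sum_j dist (y j) (y' j) =
           dist (y x) (y' x) + \sum_j dist (z j) (y' j).
  rewrite (bigD1 x) //= [in RHS](bigD1 x) //= ffunE eqxx dist_xx add0n.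
  by congr (_ + _); apply: eq_bigr => j jx; rewrite ffunE (negPf jx).
rewrite dzE addnCA addSn -add1n.
apply: (has_walkD (wreath_walk_upd _)); first exact: dist_walk.
apply: (has_walkD (v := (z, a) : wreath G H)).
  by apply: has_walk1; apply/orP; right; rewrite /= eqxx.
(* [z] is already correct at [x], so its remaining differences lie on the rest of the walk. *)
apply: IH => // j; rewrite inE ffunE; case: (eqVneq j x) => [->|jx yj].
  by rewrite eqxx.
by have := sub j; rewrite !inE (negPf jx) /=; apply.
Qed.

(** Every step is paid for by exactly one summand: a step in [G] lengthens the projected walk by
    one, and a step in [H] lowers the sum of coordinate distances by at most one. A coordinate
    changes only while the walk stands at its vertex, hence the visiting condition. *)
Lemma walk_of_wreath_walk (s : seq (wreath G H)) x y x' y' :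
    path adj ((y, x) : wreath G H) s -> last ((y, x) : wreath G H) s = (y', x') ->
  exists t : seq G,
    [/\ path adj x t, last x t = x', {subset diff_set y y' <= x :: t}
      & size t + \sum_j dist (y j) (y' j) <= size s].
Proof.
elim: s x y => [|[y1 x1] s IH] x y /=.
  move=> _ [-> ->]; exists [::]; split=> //.
    by move=> j; rewrite inE eqxx.
  by rewrite big1 // => j _; rewrite dist_xx.
move=> /andP[+ ps] /(IH _ _ ps)[t [pt lt sub le]].
case/orP=> [/and3P[/= /eqP ex /forallP eqy ya]|/= /andP[/eqP ey xa]].
  exists t; rewrite ex; rewrite -ex in ya eqy lt sub pt *; split=> //.
    move=> j; rewrite inE => yj; case: (eqVneq j x) => [->|jx].
      by rewrite mem_head.
    apply: sub; rewrite inE; have := eqy j; rewrite jx /= => /eqP <-; exact: yj.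
  have := dist_adj_le connH (y' x) ya.
  have eqr : \sum_(j | j != x) dist (y j) (y' j) =
             \sum_(j | j != x) dist (y1 j) (y' j).
    by apply: eq_bigr => j jx; have := eqy j; rewrite jx => /eqP ->.
  by move: le; rewrite (bigD1 x) //= [in X in _ -> _ -> X](bigD1 x) //= eqr; lia.
exists (x1 :: t); rewrite /= xa ey; split=> // j /sub tj.
by rewrite inE tj orbT.
Qed.

Lemma wreath_dist y x y' x' :
  dist ((y, x) : wreath G H) (y', x') =
  rho (diff_set y y') x x' + \sum_j dist (y j) (y' j).
Proof.
have /has_walk_throughP[s [sk ps lx sub]] := rho_walk connG (diff_set y y') x x'.
have walk := wreath_walk_of_walk ps sub; rewrite lx sk in walk.
apply/eqP; rewrite eqn_leq (dist_le walk) /=.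
(* For the lower bound, a shortest walk [r] in the wreath product is projected to [G]. *)
have /has_walkP[r [+ pr lr]] := least_sat walk; rewrite -/(dist _ _) => <-.
have [t [pt lt st le]] := walk_of_wreath_walk pr lr.
by apply: leq_trans le; rewrite leq_add2r -lt; apply: rho_le.
Qed.

Lemma wreath_connect (u v : wreath G H) : connect adj u v.
Proof.
case: u v => y x [y' x'].
have /has_walk_throughP[s [_ ps lx sub]] := rho_walk connG (diff_set y y') x x'.
have := wreath_walk_of_walk ps sub; rewrite lx => /has_walkP[r [_ pr lr]].
by apply/connectP; exists r.
Qed.

(** The choices are independent: any value but [y j] at [j] in [A], and only [y j] elsewhere. *)
Lemma card_diff_set y (A : {set G}) :
  #|[pred y' | diff_set y y' == A]| = #|H|.-1 ^ #|A|.
Proof.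
pose F j : {pred H} := if j \in A then predC1 (y j) else pred1 (y j).
have -> : #|[pred y' | diff_set y y' == A]| = #|family F|.
  apply: eq_card => y'; rewrite [LHS]inE; apply/eqP/familyP => [EA j|Fy].
    by rewrite /F -EA inE eq_sym; case: ifP => [|/negbT/negPn]; rewrite inE.
  apply/setP => j; have := Fy j; rewrite /F inE eq_sym.
  by case: (j \in A); rewrite inE => // ->.
rewrite card_family foldrE big_map big_enum /= (bigID (mem A)) /=.
rewrite [X in _ * X]big1 ?muln1; last first.
  by move=> j /negPf jA; rewrite /F jA card1.
rewrite -prod_nat_const; apply: eq_bigr => j jA.
by rewrite /F jA cardC1.
Qed.

(** Each value [b] at [j] is taken by [#|H| ^ #|G|.-1] functions, the other coordinates being
    free. *)
Lemma sum_ffun_at (f : H -> nat) j :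
  \sum_(y : {ffun G -> H}) f (y j) = #|H| ^ #|G|.-1 * \sum_b f b.
Proof.
rewrite (partition_big (fun y : {ffun G -> H} => y j) predT) //= big_distrr /=.
apply: eq_bigr => b _.
under eq_bigr => y /eqP -> do [].
rewrite sum_nat_const; congr (_ * _).
pose F i : {pred H} := if i == j then pred1 b else predT.
have -> : #|[pred y : {ffun G -> H} | y j == b]| = #|family F|.
  apply: eq_card => y; rewrite [LHS]inE; apply/eqP/familyP => [yj i|/(_ j)].
    by rewrite /F; case: eqP => [->|_]; rewrite inE ?yj.
  by rewrite /F eqxx inE => /eqP.
rewrite card_family foldrE big_map big_enum /= (bigD1 j) //= /F eqxx card1 mul1n.
under eq_bigr => i /negPf -> do rewrite -[#|_|]/#|H|.
by rewrite prod_nat_const cardC1.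
Qed.

Lemma wreath_total_dist y x :
  total_dist ((y, x) : wreath G H) =
  total_rho #|H|.-1 x + #|G| * #|H| ^ #|G|.-1 * \sum_j total_dist (y j).
Proof.
rewrite /total_dist.
have -> : \sum_(v : wreath G H) dist ((y, x) : wreath G H) v =
    \sum_y' \sum_x' (rho (diff_set y y') x x' + \sum_j dist (y j) (y' j)).
  rewrite pair_bigA; apply: eq_bigr => -[y' x'] _; exact: wreath_dist.
(* The coordinate distances do not depend on [x'], which gives the factor [#|G|]. *)
under eq_bigr do rewrite big_split /= sum_nat_const.
rewrite big_split /=; congr (_ + _).
  (* Grouping the [y'] by their difference set produces the weights [#|H|.-1 ^ #|A|] of
     [total_rho]. *)
  rewrite (partition_big (diff_set y) predT) //=; apply: eq_bigr => A _.
  under eq_bigr => y' /eqP -> do [].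
  by rewrite sum_nat_const card_diff_set.
rewrite -big_distrr -mulnA /=; congr (_ * _).
rewrite exchange_big big_distrr /=.
by apply: eq_bigr => j _; apply: sum_ffun_at.
Qed.

End Wreath.

(** * Medians and balance of the wreath product *)

Local Open Scope ring_scope.

Theorem theorem3p4 (G H : sgraph)
    (connG : connected_graph G) (connH : connected_graph H) :
  let m := #|H| in
  let p : rat := (m%:R - 1) / m%:R in
  (forall (y : {ffun G -> H}) (x : G),
     median ((y, x) : wreath G H) <->
     (forall j : G, median (y j)) /\ TS_median p x) /\
  (distance_balanced (wreath G H) <->
   TS_distance_balanced G p /\ distance_balanced H).
Proof.
move=> m p; case: connG connH => [G0 cG] [H0 cH].
have c_gt0 : (0 < #|G| * #|H| ^ #|G|.-1)%N by rewrite muln_gt0 G0 expn_gt0 H0.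
have updE (y : {ffun G -> H}) x b :
    (\sum_j total_dist (upd y x b j) =
     total_dist b + \sum_(j | j != x) total_dist (y j))%N.
  rewrite (bigD1 x) //= ffunE eqxx; congr addn.
  by apply: eq_bigr => j jx; rewrite ffunE (negPf jx).
split=> [y x|].
  rewrite median_total_dist (TS_median_total_rho H0); split=> [h|[hy hx] [y' x']].
    (* The two summands of the total distance can be varied separately: changing only the position
       tests [x], and changing only coordinate [j] tests [y j]. *)
    split=> [j|x']; last first.
      by have := h (y, x'); rewrite !wreath_total_dist // leq_add2r.
    apply/median_total_dist => b; have := h (upd y j b, x).
    rewrite !wreath_total_dist // leq_add2l leq_pmul2l // updE.
    by rewrite (bigD1 j) //= leq_add2r.
  rewrite !wreath_total_dist // leq_add // leq_pmul2l //.
  by apply: leq_sum => j _; have /median_total_dist := hy j; apply.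
rewrite (distance_balanced_total_dist (wreath_connect cG cH)).
rewrite (distance_balanced_total_dist cH) (TS_distance_balanced_total_rho cG H0).
have /card_gt0P[x0 _] := G0; have /card_gt0P[b0 _] := H0.
split=> [h|[hG hH] [y x] [y' x']].
  (* An edge of [G] is lifted over a constant tuple, an edge of [H] into the coordinate [x0]; each
     lift changes just one summand, and the other cancels. *)
  split=> [x x' xx'|a b ab].
    have := h ([ffun=> b0], x) ([ffun=> b0], x').
    rewrite !wreath_total_dist // => /(_ _)/addIn; apply.
    by apply/orP; right; rewrite /= eqxx.
  have := h _ _ (wreath_adj_upd [ffun=> b0] x0 ab).
  rewrite !wreath_total_dist // !updE => /addnI/eqP.
  by rewrite eqn_pmul2l // eqn_add2r => /eqP.
(* Conversely, an edge of the wreath product moves either the position along an edge of [G] or the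
   single coordinate [x] along an edge of [H]. *)
case/orP=> [/and3P[/= /eqP <- /forallP eqy ya]|/= /andP[/eqP <- xx']]; last first.
  by rewrite !wreath_total_dist // (hG _ _ xx').
rewrite !wreath_total_dist //; congr (_ + _ * _)%N; apply: eq_bigr => j _.
by have := eqy j; case: (eqVneq j x) => [-> _|_ /= /eqP ->] //; apply: hH.
Qed.
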